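(* If $S\subset k\{X\}$ is a non-empty set with $|S|<\infty$ and $S$ is $D\cup X$-homogeneous, then the commutative differential algebra $k\{X|S\}=k\{X\}/Id[S]$ has a solvable word problem; that is, there is an algorithm which, given $f\in k\{X\}$, decides whether $f\in Id[S]$.
   Context: Let $k$ be a field of characteristic $0$ and $X$ a well-ordered set. $k\{X\}$ is the free commutative differential algebra on $X$: the commutative polynomial algebra over $k$ in the letters $a[i]$ ($a\in X$, $i\ge -1$), with the $k$-linear derivation $D$ given by $D(a[i])=a[i+1]$, $D(1)=0$ (so $a[-1]=a$, $a[i]=D^{i+1}a$). $[D^{\omega}X]$ is the free commutative monoid on these letters, a $k$-basis of $k\{X\}$. For $w=a_n[i_n]\cdots a_1[i_1]$ put $wt(w)=i_1+\dots+i_n$ and $|w|_{D\cup X}=wt(w)+2n$ (the number of occurrences of $D$ and of generators from $X$ in $w$); $|1|_{D\cup X}=0$. A set $S\subseteq k\{X\}$ is $D\cup X$-homogeneous if for every $f\in S$ all words occurring in $f$ with nonzero coefficient have the same $|\cdot|_{D\cup X}$. $Id[S]$ is the differential ideal of $k\{X\}$ generated by $S$, i.e. the span of all $uD^ts$ with $u\in[D^\omega X]$, $t\in\mathbb{N}=\{0,1,2,\dots\}$, $s\in S$. For algorithmic purposes, arithmetic and equality testing in $k$ and comparison of elements of $X$ are regarded as effective primitive operations. *)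

(* Defs.v *)
From HB Require Import structures.
From mathcomp Require Import all_boot all_order all_algebra finmap.
From mathcomp Require Import zify.
From mathcomp.multinomials Require Import monalg.

Set Implicit Arguments.
Unset Strict Implicit.
Unset Printing Implicit Defensive.

Import Order.TTheory GRing.Theory Num.Theory.
Local Open Scope ring_scope.

(* The letter a[i], i >= -1, is the pair (a, i + 1), so that (a, n) stands for *)
(* D^n a.                                                                      *)
Definition letter (X : Type) : Type := (X * nat)%type.
HB.instance Definition _ (X : choiceType) := Choice.on (letter X).

Definition next_letter (X : Type) (l : letter X) : letter X := (l.1, l.2.+1).

Notation word X := {cmonom (letter X)}.

Notation dpoly k X := {malg k[word X]}.

Section DiffAlgebra.
Context (k : fieldType) (X : choiceType).
Implicit Types (u v w : word X) (f g h : dpoly k X) (l : letter X).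

Definition var l : dpoly k X := << ucm l >>.

(* D w is the sum over the letters l of w, with multiplicity, of w with one    *)
(* occurrence of l replaced by next_letter l.                                  *)
Definition Dword w : dpoly k X :=
  \sum_(l <- finsupp w)
     (w l)%:R *: << (mmul (divcm w (ucm l)) (ucm (next_letter l)))%M >>.

Definition D f : dpoly k X := \sum_(w <- msupp f) f@_w *: Dword w.

Definition wt w : int := \sum_(l <- finsupp w) (w l)%:Z * (l.2%:Z - 1).

Definition DXlen w : int := wt w + 2 * (mdeg w)%:Z.

Definition DX_homogeneous (S : {fset dpoly k X}) : Prop :=
  forall f, f \in S ->
  forall u v, u \in msupp f -> v \in msupp f -> DXlen u = DXlen v.

Record diff_ideal (I : dpoly k X -> Prop) : Prop := DiffIdeal {
  diff_ideal0 : I 0;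
  diff_idealD : forall f g, I f -> I g -> I (f + g);
  diff_idealM : forall h f, I f -> I (h * f);
  diff_idealder : forall f, I f -> I (D f)
}.

Definition Id (S : {fset dpoly k X}) f : Prop :=
  forall I, diff_ideal I -> (forall s, s \in S -> I s) -> I f.

Lemma DwordEw (d : {fset letter X}) w : (finsupp w `<=` d)%fset ->
  Dword w = \sum_(l <- d)
     (w l)%:R *: << (mmul (divcm w (ucm l)) (ucm (next_letter l)))%M >>.
Proof.
move=> le_wd; rewrite /Dword.
apply/(big_fset_incl _ le_wd) => l _.
by rewrite -cmE_eq0 => /eqP ->; rewrite scale0r.
Qed.

Lemma DEw (d : {fset word X}) f : (msupp f `<=` d)%fset ->
  D f = \sum_(w <- d) f@_w *: Dword w.
Proof.
move=> le_fd; apply/(big_fset_incl _ le_fd) => w _ /mcoeff_outdom ->.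
by rewrite scale0r.
Qed.

Lemma D_is_linear : linear D.
Proof.
move=> c f g.
have := DEw (d := (msupp f `|` msupp g)%fset) (f := c *: f + g).
rewrite (DEw (fsubsetUl (msupp f) (msupp g))).
rewrite (DEw (fsubsetUr (msupp f) (msupp g))) => ->.
  rewrite scaler_sumr -big_split /=; apply: eq_bigr => w _.
  by rewrite mcoeffD mcoeffZ scalerDl scalerA.
apply: (fsubset_trans (msuppD_le _ _)).
by apply: fsetSU; exact: msuppZ_le.
Qed.

HB.instance Definition _ :=
  GRing.isLinear.Build k (dpoly k X) (dpoly k X) *:%R D D_is_linear.

Lemma D_word w : D << w >> = Dword w.
Proof.
by rewrite /D msuppU1 big_seq_fset1 mcoeffUU scale1r.
Qed.

Lemma D_var l : D (var l) = var (next_letter l).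
Proof.
rewrite D_word /Dword mdomU big_seq_fset1 cmUU scale1r; congr << _ >>.
by apply/eqP/cmP => i; rewrite cmM divcmE subnn.
Qed.

Lemma D_one : D 1 = 0.
Proof. by rewrite D_word /Dword mdom1 big_seq_fset0. Qed.

Lemma mulUU u v : << u >> * << v >> = << (mmul u v)%M >> :> dpoly k X.
Proof. by rewrite malgM_def fgmulUU mulr1. Qed.

Let scaleAl (c : k) f g : (c *: f) * g = c *: (f * g).
Proof. by rewrite -scalerAl. Qed.

Let scaleAr (c : k) f g : f * (c *: g) = c *: (f * g).
Proof. by rewrite mulrC scaleAl mulrC. Qed.

Lemma malgUE (c : k) w : << c *g w >> = c *: << w >> :> dpoly k X.
Proof.
by rewrite -mul_malgC malgM_def fgmulUU mul1m mulr1.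
Qed.

Lemma Dword_mul u v : Dword (mmul u v) = Dword u * << v >> + << u >> * Dword v.
Proof.
have E : finsupp (mmul u v) = (finsupp u `|` finsupp v)%fset by rewrite mdomD.
rewrite {1}/Dword E (DwordEw (fsubsetUl (finsupp u) (finsupp v))).
rewrite (DwordEw (fsubsetUr (finsupp u) (finsupp v))).
rewrite mulr_suml mulr_sumr -big_split /=; apply: eq_bigr => l _.
rewrite cmM natrD scalerDl; congr (_ + _).
  apply/esym; apply: etrans (scaleAl _ _ _) _; rewrite mulUU.
  case: (posnP (u l)) => [->|u_gt0].
    by apply: etrans (scale0r _) (esym (scale0r _)).
  congr (_ *: << _ >>); apply/eqP/cmP => i.
  rewrite !cmM !divcmE !cmM cmU; case: eqP => [<-|_]; last by lia.
  by lia.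
apply/esym; apply: etrans (scaleAr _ _ _) _; rewrite mulUU.
case: (posnP (v l)) => [->|v_gt0].
  by apply: etrans (scale0r _) (esym (scale0r _)).
congr (_ *: << _ >>); apply/eqP/cmP => i.
rewrite !cmM !divcmE !cmM cmU; case: eqP => [<-|_]; last by lia.
by lia.
Qed.

Let malg_ind (P : dpoly k X -> Prop) : P 0 ->
  (forall c w f, P f -> P (c *: << w >> + f)) -> forall f, P f.
Proof.
move=> P0 PS f; rewrite (monalgE f); elim: {1}(enum_fset _) => [|w r IHr].
  by rewrite big_nil.
by rewrite big_cons malgUE; apply: PS.
Qed.

Let D_mul_word u g : D (<< u >> * g) = Dword u * g + << u >> * D g.
Proof.
have algE (A : comAlgType k) (c : k) (x y dx dy z dz : A) :
  c *: (dx * y + x * dy) + (dx * z + x * dz)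
    = dx * (c *: y + z) + x * (c *: dy + dz).
  by rewrite !mulrDr -!scalerAr scalerDr addrACA.
elim/malg_ind: g => [|c v g IHg]; first by rewrite !(mulr0, linear0) addr0.
have -> : << u >> * (c *: << v >> + g) = c *: << mmul u v >> + << u >> * g.
  rewrite mulrDr; congr (_ + _).
  by apply: etrans (scaleAr _ _ _) _; rewrite mulUU.
apply: etrans (D_is_linear _ _ _) _; rewrite IHg D_word Dword_mul.
by rewrite [X in _ = _ + _ * X]D_is_linear D_word; apply: algE.
Qed.

Lemma D_mul f g : D (f * g) = D f * g + f * D g.
Proof.
have algE (A : comAlgType k) (c : k) (x y dx dy z dz : A) :
  c *: (dx * y + x * dy) + (dz * y + z * dy)
    = (c *: dx + dz) * y + (c *: x + z) * dy.
  by rewrite !mulrDl -!scalerAl scalerDr addrACA.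
elim/malg_ind: f => [|c v f IHf]; first by rewrite !(mul0r, linear0) addr0.
have -> : (c *: << v >> + f) * g = c *: (<< v >> * g) + f * g.
  by rewrite mulrDl; congr (_ + _); apply: scaleAl.
apply: etrans (D_is_linear _ _ _) _.
apply: etrans (congr2 (fun a b => c *: a + b) (D_mul_word v g) IHf) _.
rewrite (D_is_linear c << v >> f) D_word; exact: algE.
Qed.

(* The differential ideal generated by S is the span of the u D^t s.           *)
Lemma Id_span S f : Id S f <->
  exists r : seq (k * word X * nat * dpoly k X),
    all (fun q => q.2 \in S) r /\
    f = \sum_(q <- r) q.1.1.1 *: (<< q.1.1.2 >> * iter q.1.2 D q.2).
Proof.
split; last first.
  case=> r [rS ->] I [I0 ID IM Ider] IS.
  elim: r rS => [|[[[c u] t] s] r IHr] /=; first by rewrite big_nil.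
  case/andP=> sS /IHr Ir; rewrite big_cons /=; apply: ID => //.
  rewrite -mul_malgC; apply/IM/IM; elim: t => [|t It] /=; last exact: Ider.
  exact: IS.
pose T (q : k * word X * nat * dpoly k X) : dpoly k X :=
  q.1.1.1 *: (<< q.1.1.2 >> * iter q.1.2 D q.2).
pose P f := exists r : seq (k * word X * nat * dpoly k X),
  all (fun q => q.2 \in S) r /\ f = \sum_(q <- r) T q.
have P0 : P 0 by exists [::]; rewrite big_nil.
have PD g h : P g -> P h -> P (g + h).
  case=> r [rS ->] [r' [rS' ->]]; exists (r ++ r').
  by rewrite all_cat rS rS' big_cat.
have Psum (A : Type) (r : seq A) F :
    (forall a, P (F a)) -> P (\sum_(a <- r) F a).
  by move=> PF; elim/big_ind: _.
have P1 c u t s : s \in S -> P (c *: (<< u >> * iter t D s)).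
  by move=> sS; exists [:: (c, u, t, s)]; rewrite /= sS big_seq1.
have P2 h t s : s \in S -> P (h * iter t D s).
  move=> sS; rewrite (monalgE h) mulr_suml; apply: Psum => w.
  by rewrite malgUE scaleAl; apply: P1.
have Pall (G : dpoly k X -> dpoly k X) : G 0 = 0 -> {morph G : x y / x + y} ->
    (forall c u t s, s \in S -> P (G (c *: (<< u >> * iter t D s)))) ->
    forall f, P f -> P (G f).
  move=> G0 GD PG _ [r [rS ->]].
  elim: r rS => [|[[[c u] t] s] r IHr] /=; first by rewrite big_nil G0.
  by case/andP=> sS /IHr Pr; rewrite big_cons GD; apply: PD => //; apply: PG.
move=> IdSf; apply: (IdSf P); first split=> //.
- move=> h; apply: (Pall ( *%R h)); [exact: mulr0 | exact: mulrDr |].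
  move=> c u t s sS.
  have -> : h * (c *: (<< u >> * iter t D s)) =
      (c *: (h * << u >>)) * iter t D s.
    apply: etrans (scaleAr _ _ _) _; rewrite mulrA.
    by apply: esym (scaleAl _ _ _).
  exact: P2.
- apply: (Pall D); [exact: linear0 | exact: linearD |].
  move=> c u t s sS.
  have -> : D (c *: (<< u >> * iter t D s)) =
      (c *: Dword u) * iter t D s + c *: (<< u >> * iter t.+1 D s).
    apply: etrans (linearZ_LR _ _ _) _; rewrite /= D_mul D_word scalerDr.
    by congr (_ + _); apply: esym (scaleAl _ _ _).
  by apply: PD; [apply: P2 | apply: P1].
by move=> s sS; have := P2 1 0%N s sS; rewrite mul1r.
Qed.

End DiffAlgebra.

(* Algorithms over k and X: Jones's language WHILE in point-free form. It      *)
(* computes on binary trees whose leaves are nil or atoms taken from k and X;  *)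
(* the only operations on atoms are the field operations and the equality test *)
(* of k, and the comparison of X. A program is a finite object in which        *)
(* finitely many elements of k and X may occur as constants.                   *)
Inductive data (K A : Type) : Type :=
| Nil
| Scal of K
| Gen of A
| Pair of data K A & data K A.

Arguments Nil {K A}.
Arguments Scal {K A} _.
Arguments Gen {K A} _.

Inductive prog (K A : Type) : Type :=
| PId
| PConst of data K A
| PFst
| PSnd
| PPair of prog K A & prog K A
| PComp of prog K A & prog K A
| PIf of prog K A & prog K A & prog K A
| PWhile of prog K A & prog K A
| PAdd
| POpp
| PMul
| PInv
| PEqScal
| PLeGen.

Arguments PId {K A}.
Arguments PFst {K A}.
Arguments PSnd {K A}.
Arguments PAdd {K A}.
Arguments POpp {K A}.
Arguments PMul {K A}.
Arguments PInv {K A}.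
Arguments PEqScal {K A}.
Arguments PLeGen {K A}.

Section Semantics.
Context (k : fieldType) (disp : Order.disp_t) (X : orderType disp).
Local Notation data := (data k X).
Local Notation prog := (prog k X).
Implicit Types (x y z : data) (p q r : prog).

Definition of_bool (b : bool) : data := if b then Pair Nil Nil else Nil.

Definition is_true_data x : bool := if x is Nil then false else true.

Definition dfst x : data := if x is Pair y _ then y else Nil.
Definition dsnd x : data := if x is Pair _ z then z else Nil.

Definition dadd x : data :=
  if x is Pair (Scal a) (Scal b) then Scal (a + b) else Nil.
Definition dopp x : data := if x is Scal a then Scal (- a) else Nil.
Definition dmul x : data :=
  if x is Pair (Scal a) (Scal b) then Scal (a * b) else Nil.
Definition dinv x : data := if x is Scal a then Scal a^-1 else Nil.
Definition deq x : data :=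
  if x is Pair (Scal a) (Scal b) then of_bool (a == b) else Nil.
Definition dle x : data :=
  if x is Pair (Gen a) (Gen b) then of_bool (a <= b)%O else Nil.

(* eval p x y: the program p halts on the input x, with output y.              *)
Inductive eval : prog -> data -> data -> Prop :=
| EId x : eval PId x x
| EConst y x : eval (PConst y) x y
| EFst x : eval PFst x (dfst x)
| ESnd x : eval PSnd x (dsnd x)
| EPair p q x y z : eval p x y -> eval q x z -> eval (PPair p q) x (Pair y z)
| EComp p q x y z : eval q x y -> eval p y z -> eval (PComp p q) x z
| EIf p q r x y z : eval p x y ->
    eval (if is_true_data y then q else r) x z -> eval (PIf p q r) x z
| EWhileStop p q x y : eval p x y -> ~~ is_true_data y ->
    eval (PWhile p q) x x
| EWhileStep p q x y x' z : eval p x y -> is_true_data y -> eval q x x' ->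
    eval (PWhile p q) x' z -> eval (PWhile p q) x z
| EAdd x : eval PAdd x (dadd x)
| EOpp x : eval POpp x (dopp x)
| EMul x : eval PMul x (dmul x)
| EInv x : eval PInv x (dinv x)
| EEqScal x : eval PEqScal x (deq x)
| ELeGen x : eval PLeGen x (dle x).

Lemma eval_det p x y z : eval p x y -> eval p x z -> y = z.
Proof.
move=> H; elim: H z => {p x y}.
- by move=> x z H; inversion H.
- by move=> y x z H; inversion H.
- by move=> x z H; inversion H.
- by move=> x z H; inversion H.
- by move=> p q x y z _ IHp _ IHq z' H; inversion H; subst; congr Pair; auto.
- move=> p q x y z _ IHq _ IHp z' H; inversion H; subst.
  by apply: IHp; rewrite (IHq y0).
- move=> p q r x y z _ IHp _ IHb z' H; inversion H; subst.
  by apply: IHb; rewrite (IHp y0).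
- move=> p q x y _ IHp yF z H; inversion H; subst=> //.
  by move: yF; rewrite (IHp y0) // H3.
- move=> p q x y x' z _ IHp yT _ IHq _ IHw z' H; inversion H; subst.
    by move: H5; rewrite -(IHp y0) // yT.
  by apply: IHw; rewrite (IHq x'0).
all: by move=> x z H; inversion H.
Qed.

(* Elements of k{X} are given to a program as linear combinations of words,    *)
(* each word being a list of letters; any such presentation is allowed:        *)
(* repeated words, letters in any order, zero coefficients.                    *)
Definition presentation : Type := seq (k * seq (letter X)).

Definition denote (t : presentation) : dpoly k X :=
  \sum_(m <- t) m.1 *: \prod_(l <- m.2) var k l.

Lemma denote_surj (f : dpoly k X) : exists t, denote t = f.
Proof.
have words (w : word X) : exists s, \prod_(l <- s) var k l = << w >>.
  have [n] := ubnP (mdeg w); elim: n w => // n IHn w le_wn.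
  have [w0|[l lw]] := fset_0Vmem (finsupp w).
    exists [::]; rewrite big_nil; congr << _ >>; apply/eqP/cmP => l.
    by rewrite cm1; apply/esym/eqP; rewrite cmE_eq0 w0.
  have wE : w = mmul (ucm l) (divcm w (ucm l)).
    apply/eqP/cmP => i; rewrite cmM divcmE cmU; case: eqP => [<-|_] /=.
      by rewrite subnKC // lt0n cmE_neq0.
    by rewrite subn0.
  have [|s sE] := IHn (divcm w (ucm l)).
    by move: le_wn; rewrite {1}wE mdegM mdegU.
  exists (l :: s); rewrite big_cons sE {2}wE; exact: mulUU.
rewrite (monalgE f); elim: {1}(enum_fset _) => [|w r [t tE]].
  by exists [::]; rewrite /denote !big_nil.
have [s sE] := words w; exists ((f@_w, s) :: t).
rewrite /denote !big_cons -tE /= sE; congr (_ + _).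
exact: esym (malgUE _ _).
Qed.

Fixpoint enc_seq (T : Type) (enc : T -> data) (s : seq T) : data :=
  if s is a :: s' then Pair (enc a) (enc_seq enc s') else Nil.

Definition enc_nat (n : nat) : data := enc_seq (fun=> Nil) (nseq n tt).

Definition enc_letter (l : letter X) : data := Pair (Gen l.1) (enc_nat l.2).

Definition enc_term (m : k * seq (letter X)) : data :=
  Pair (Scal m.1) (enc_seq enc_letter m.2).

Definition encode (t : presentation) : data := enc_seq enc_term t.

Definition decides (p : prog) (P : dpoly k X -> Prop) : Prop :=
  forall (f : dpoly k X) (t : presentation), denote t = f ->
    (P f -> eval p (encode t) (of_bool true)) /\
    (~ P f -> eval p (encode t) (of_bool false)).

Definition solvable_word_problem (S : {fset dpoly k X}) : Prop :=
  exists p : prog, decides p (Id S).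

End Semantics.

(* Main.v *)
(* The spanning set [u D^t s] of [Id S] is homogeneous, and both [D] and       *)
(* multiplication by a letter increase [DXlen]. Hence [f] of length at most n  *)
(* lies in [Id S] iff it lies in the linear span of the finitely many          *)
(* [u D^t s] of length at most n in the generators occurring in [f] or [S].    *)
(* These are all obtained from S by n rounds of applying [D] and multiplying   *)
(* by letters; surplus elements of [Id S] produced on the way are harmless.    *)
(* Membership in the span is decided by Gaussian elimination.                  *)

Require Import Defs.
From HB Require Import structures.
From mathcomp Require Import all_boot all_order all_algebra finmap zify.
From mathcomp.multinomials Require Import monalg.

Set Implicit Arguments.
Unset Strict Implicit.
Unset Printing Implicit Defensive.

Import Order.TTheory GRing.Theory.
Local Open Scope ring_scope.

(** By [Id_span], [Id S] is the linear span of the products [u D^a s]. If [s] is homogeneous, so is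
    each such product: a letter [(x, i)] has length [i + 1], multiplication by [u] adds the length
    of [u], and each [D] adds exactly 1. Let [n] bound the lengths of the words of [f], and let [G]
    be the generators occurring in [f] or [S]. Truncation to the words over [G] of length at most
    [n] is linear, fixes [f], and fixes or kills each [u D^a s] as a whole. Applied to an expression
    of [f], it leaves only products with [u] over [G] and the length of [u] plus [a] at most [n].
    These belong to an explicit finite family, obtained from [S] by [n] rounds of [grow], so [f]
    lies in its span ([decide_complete]); conversely, everything grown lies in the ideal
    ([decide_sound]). Membership in the span is decided by elimination on pivots ([lin_span_elim],
    [in_spanP]).

    On the program side, every function of the algorithm is built from folds, maps and bounded
    iterations, under which [computable] is closed. The only [PWhile] loop is the one in
    [computable_foldl]. [computable_decide] assembles the program, in which presentations of the
    elements of [S] are constants. *)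

Section Computable.
Context (k : fieldType) (disp : Order.disp_t) (X : orderType disp).
Local Notation data := (data k X).
Local Notation enc_bool := (@of_bool k _ X).
Local Notation enc_nat := (@enc_nat k _ X).

(** The program has to halt on codes of elements of [A] only; its behaviour on other data is left
    open. *)
Definition computable (A B : Type) (ea : A -> data) (eb : B -> data)
    (f : A -> B) : Prop :=
  exists p, forall x, eval p (ea x) (eb (f x)).

Definition enc_pair (A B : Type) (ea : A -> data) (eb : B -> data)
    (x : A * B) : data := Pair (ea x.1) (eb x.2).

(** * Closure of computable functions under the basic program constructs and folds *)

Section Combinators.
Context (E A B T : Type).
Context (ee : E -> data) (ea : A -> data) (eb : B -> data) (et : T -> data).

Lemma eq_computable (f g : A -> B) :
  f =1 g -> computable ea eb f -> computable ea eb g.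
Proof. by move=> fg [p pf]; exists p => x; rewrite -fg. Qed.

Lemma computable_id : computable ea ea (fun x => x).
Proof. by exists PId => x; constructor. Qed.

Lemma computable_const (b : B) : computable ea eb (fun=> b).
Proof. by exists (PConst (eb b)) => x; constructor. Qed.

Lemma computable_comp (g : A -> B) (f : E -> A) :
  computable ea eb g -> computable ee ea f ->
  computable ee eb (fun x => g (f x)).
Proof.
by move=> [p pg] [q qf]; exists (PComp p q) => x; apply: EComp (qf x) (pg _).
Qed.

Lemma computable_pair (f : E -> A) (g : E -> B) :
  computable ee ea f -> computable ee eb g ->
  computable ee (enc_pair ea eb) (fun x => (f x, g x)).
Proof. by move=> [p pf] [q qg]; exists (PPair p q) => x; apply: EPair. Qed.

Lemma computable_fst (f : E -> A * B) :
  computable ee (enc_pair ea eb) f -> computable ee ea (fun x => (f x).1).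
Proof.
move=> [p pf]; exists (PComp PFst p) => x; apply: EComp (pf x) _.
exact: (EFst (enc_pair ea eb (f x))).
Qed.

Lemma computable_snd (f : E -> A * B) :
  computable ee (enc_pair ea eb) f -> computable ee eb (fun x => (f x).2).
Proof.
move=> [p pf]; exists (PComp PSnd p) => x; apply: EComp (pf x) _.
exact: (ESnd (enc_pair ea eb (f x))).
Qed.

Lemma computable_if (b : E -> bool) (f g : E -> A) :
  computable ee enc_bool b -> computable ee ea f -> computable ee ea g ->
  computable ee ea (fun x => if b x then f x else g x).
Proof.
move=> [p pb] [q qf] [r rg]; exists (PIf p q r) => x.
by apply: EIf (pb x) _; case: (b x).
Qed.

Lemma computable_cons (f : E -> T) (g : E -> seq T) :
  computable ee et f -> computable ee (enc_seq et) g ->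
  computable ee (enc_seq et) (fun x => f x :: g x).
Proof. by move=> [p pf] [q qg]; exists (PPair p q) => x; apply: EPair. Qed.

Lemma computable_behead (f : E -> seq T) :
  computable ee (enc_seq et) f ->
  computable ee (enc_seq et) (fun x => behead (f x)).
Proof.
move=> [p pf]; exists (PComp PSnd p) => x; apply: EComp (pf x) _.
by case: (f x) => [|a s]; [exact: (ESnd Defs.Nil) | exact: (ESnd (Pair _ _))].
Qed.

(** Restricted to lists of lists because the default then comes for free: [dfst] sends [Nil] to
    [Nil], the code of the empty list. *)
Lemma computable_head_nil (f : E -> seq (seq T)) :
  computable ee (enc_seq (enc_seq et)) f ->
  computable ee (enc_seq et) (fun x => head [::] (f x)).
Proof.
move=> [p pf]; exists (PComp PFst p) => x; apply: EComp (pf x) _.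
by case: (f x) => [|a s]; [exact: (EFst Defs.Nil) | exact: (EFst (Pair _ _))].
Qed.

Lemma computable_foldl (f : E -> A -> T -> A) (i : E -> A) (s : E -> seq T) :
  computable (enc_pair ee (enc_pair ea et)) ea (fun x => f x.1 x.2.1 x.2.2) ->
  computable ee ea i -> computable ee (enc_seq et) s ->
  computable ee ea (fun x => foldl (f x) (i x) (s x)).
Proof.
move=> [p pf] [q qi] [r rs].
(* The loop state consists of the environment, the accumulator and the remaining list. The code of
   that list serves as the loop test, since only [Nil] counts as false. *)
pose body := PPair PFst (PPair
  (PComp p
    (PPair PFst (PPair (PComp PFst PSnd) (PComp PFst (PComp PSnd PSnd)))))
  (PComp PSnd (PComp PSnd PSnd))).
have loop x t a : eval (PWhile (PComp PSnd PSnd) body)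
    (Pair (ee x) (Pair (ea a) (enc_seq et t)))
    (Pair (ee x) (Pair (ea (foldl (f x) a t)) Defs.Nil)).
  elim: t a => [|b t IHt] a.
    apply: (@EWhileStop _ _ _ _ _ _ Defs.Nil) => //.
    by apply: EComp (ESnd _) (ESnd _).
  have get3 : eval (PComp PSnd PSnd)
      (Pair (ee x) (Pair (ea a) (enc_seq et (b :: t)))) (enc_seq et (b :: t)).
    by apply: EComp (ESnd _) (ESnd _).
  apply: (EWhileStep get3) (IHt (f x a b)) => //.
  apply: EPair; first exact: EFst.
  apply: EPair; last by apply: EComp get3 (ESnd _).
  apply: EComp (pf (x, (a, b))); apply: EPair; first exact: EFst.
  apply: EPair; first by apply: EComp (ESnd _) (EFst _).
  by apply: EComp get3 (EFst _).
exists (PComp (PComp PFst PSnd)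
  (PComp (PWhile (PComp PSnd PSnd) body) (PPair PId (PPair q r)))) => x.
apply: EComp (EComp _ (loop x (s x) (i x))) _.
  by apply: EPair; [exact: EId | exact: EPair].
exact: EComp (ESnd (Pair _ (Pair _ _))) (EFst (Pair _ _)).
Qed.

End Combinators.

Section Foldr.
Context (E A B C T : Type).
Context (ee : E -> data) (ea : A -> data) (eb : B -> data) (ec : C -> data).
Context (et : T -> data).

Lemma computable2 (g : A -> B -> C) (f1 : E -> A) (f2 : E -> B) :
  computable (enc_pair ea eb) ec (fun x => g x.1 x.2) ->
  computable ee ea f1 -> computable ee eb f2 ->
  computable ee ec (fun x => g (f1 x) (f2 x)).
Proof.
move=> Hg H1 H2; exact: (computable_comp Hg (computable_pair H1 H2)).
Qed.

Lemma computable_rev (s : E -> seq T) :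
  computable ee (enc_seq et) s ->
  computable ee (enc_seq et) (fun x => rev (s x)).
Proof.
move=> Hs; have : computable ee (enc_seq et)
    (fun x => foldl (fun a b => b :: a) [::] (s x)).
  apply: computable_foldl Hs; last exact: computable_const.
  apply: computable_cons;
    last exact/computable_fst/computable_snd/computable_id.
  exact/computable_snd/computable_snd/computable_id.
apply: eq_computable => x; rewrite /rev.
by elim: (s x) [::] => //= a t IHt r; rewrite IHt.
Qed.

Lemma computable_foldr (f : E -> T -> A -> A) (i : E -> A) (s : E -> seq T) :
  computable (enc_pair ee (enc_pair et ea)) ea (fun x => f x.1 x.2.1 x.2.2) ->
  computable ee ea i -> computable ee (enc_seq et) s ->
  computable ee ea (fun x => foldr (f x) (i x) (s x)).
Proof.
move=> Hf Hi Hs.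
apply: (eq_computable
  (f := fun x => foldl (fun a t => f x t a) (i x) (rev (s x)))).
  by move=> x; rewrite foldl_rev.
apply: computable_foldl (computable_rev Hs) => //.
apply: (computable_comp (f := fun x => (x.1, (x.2.2, x.2.1))) Hf).
apply: computable_pair; first exact/computable_fst/computable_id.
apply: computable_pair.
  exact/computable_snd/computable_snd/computable_id.
exact/computable_fst/computable_snd/computable_id.
Qed.

End Foldr.

End Computable.

(** Finds the path of projections from the encoded environment to the wanted component. *)
Ltac computable_proj := solve [ eassumption | eapply computable_id
  | eapply computable_fst; computable_proj
  | eapply computable_snd; computable_proj ].

(** * Computability of list operations, unary arithmetic and the primitives on atoms *)

Section ComputableLists.
Context (k : fieldType) (disp : Order.disp_t) (X : orderType disp).
Local Notation data := (data k X).
Local Notation enc_bool := (@of_bool k _ X).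
Local Notation enc_nat := (@enc_nat k _ X).

Section CatSucc.
Context (E T : Type) (ee : E -> data) (et : T -> data).

Lemma computable_cat (f g : E -> seq T) :
  computable ee (enc_seq et) f -> computable ee (enc_seq et) g ->
  computable ee (enc_seq et) (fun x => f x ++ g x).
Proof.
move=> Hf Hg.
apply: (eq_computable (f := fun x => foldr cons (g x) (f x))).
  by move=> x; elim: (f x) => //= a t ->.
apply: (computable_foldr (f := fun=> cons)) Hg Hf.
by apply: computable_cons; computable_proj.
Qed.

Lemma computable_succn (n : E -> nat) : computable ee enc_nat n ->
  computable ee enc_nat (fun x => (n x).+1).
Proof.
move=> [p pn]; exists (PPair (PConst Defs.Nil) p) => x.
by apply: EPair; [exact: EConst | exact: pn].
Qed.

Lemma computable_predn (n : E -> nat) : computable ee enc_nat n ->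
  computable ee enc_nat (fun x => (n x).-1).
Proof.
move=> [p pn]; exists (PComp PSnd p) => x; apply: EComp (pn x) _.
by case: (n x) => [|m]; [exact: (ESnd Defs.Nil) | exact: (ESnd (Pair _ _))].
Qed.

End CatSucc.

Section Iterators.
Context (E A T U : Type).
Context (ee : E -> data) (ea : A -> data) (et : T -> data) (eu : U -> data).

Lemma computable_flatten (f : E -> seq (seq T)) :
  computable ee (enc_seq (enc_seq et)) f ->
  computable ee (enc_seq et) (fun x => flatten (f x)).
Proof.
move=> Hf; apply: (computable_foldr (f := fun=> cat) (i := fun=> [::])) Hf.
  by apply: computable_cat; computable_proj.
exact: computable_const.
Qed.

Lemma computable_map (f : E -> T -> U) (s : E -> seq T) :
  computable (enc_pair ee et) eu (fun x => f x.1 x.2) ->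
  computable ee (enc_seq et) s ->
  computable ee (enc_seq eu) (fun x => [seq f x t | t <- s x]).
Proof.
move=> Hf Hs.
apply: (eq_computable (f := fun x => foldr (fun t r => f x t :: r) [::] (s x))).
  by move=> x; elim: (s x) => //= a t ->.
apply: computable_foldr Hs; last exact: computable_const.
apply: computable_cons; last computable_proj.
by apply: (computable2 Hf); computable_proj.
Qed.

Lemma computable_all (a : E -> T -> bool) (s : E -> seq T) :
  computable (enc_pair ee et) enc_bool (fun x => a x.1 x.2) ->
  computable ee (enc_seq et) s ->
  computable ee enc_bool (fun x => all (a x) (s x)).
Proof.
move=> Ha Hs.
apply: (eq_computable (f := fun x =>
  foldr (fun t b => if a x t then b else false) true (s x))).
  by move=> x; elim: (s x) => //= b t ->.
apply: computable_foldr Hs; last exact: computable_const.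
apply: computable_if; [|computable_proj|exact: computable_const].
by apply: (computable2 Ha); computable_proj.
Qed.

Lemma computable_iter (n : E -> nat) (f : E -> A -> A) (i : E -> A) :
  computable (enc_pair ee ea) ea (fun x => f x.1 x.2) ->
  computable ee enc_nat n -> computable ee ea i ->
  computable ee ea (fun x => iter (n x) (f x) (i x)).
Proof.
move=> Hf Hn Hi.
apply: (eq_computable
  (f := fun x => foldr (fun _ a => f x a) (i x) (nseq (n x) tt))).
  by move=> x; elim: (n x) => //= m ->.
(* By definition [enc_nat] codes a number as a list of [Nil]s of that length, so [Hn] also serves as
   the hypothesis on the list. *)
apply: (computable_foldr (f := fun x _ a => f x a)
   (et := fun=> Defs.Nil) _ Hi); last exact: Hn.
by apply: (computable2 Hf); computable_proj.
Qed.

End Iterators.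

Section Primitives.
Context (E T : Type) (ee : E -> data) (et : T -> data).

Lemma computable_eqn (m n : E -> nat) :
  computable ee enc_nat m -> computable ee enc_nat n ->
  computable ee enc_bool (fun x => m x == n x).
Proof.
have Hleq (u v : E -> nat) :
    computable ee enc_nat u -> computable ee enc_nat v ->
    computable ee enc_bool (fun x => (u x <= v x)%N).
  move=> Hu Hv.
  have : computable ee enc_nat (fun x => iter (v x) predn (u x)).
    by apply: (computable_iter (f := fun=> predn)) => //;
       apply: computable_predn; computable_proj.
  move=> [p pE].
  (* The unary code of the truncated difference is [Nil] exactly when [u x <= v x], hence the order
     of the two branches. *)
  exists (PIf p (PConst Defs.Nil) (PConst (of_bool _ _ true))) => x.
  by apply: EIf (pE x) _; rewrite iter_predn -subn_eq0; case: (_ - _)%N => [|?];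
     exact: EConst.
move=> Hm Hn; apply: (eq_computable (f := fun x =>
  if (m x <= n x)%N then (n x <= m x)%N else false)).
  by move=> x; rewrite eqn_leq.
by apply: computable_if; [exact: Hleq | exact: Hleq | exact: computable_const].
Qed.

Lemma computable_addn (m n : E -> nat) :
  computable ee enc_nat m -> computable ee enc_nat n ->
  computable ee enc_nat (fun x => m x + n x)%N.
Proof.
move=> Hm Hn; apply: (eq_computable (f := fun x => iter (m x) S (n x))).
  by move=> x; rewrite iter_succn addnC.
by apply: (computable_iter (f := fun=> S)) => //;
   apply: computable_succn; computable_proj.
Qed.

Lemma computable_size (s : E -> seq T) : computable ee (enc_seq et) s ->
  computable ee enc_nat (fun x => size (s x)).
Proof.
apply: (computable_foldr (f := fun _ _ => S) (i := fun=> 0%N)).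
  by apply: computable_succn; computable_proj.
exact: computable_const.
Qed.

Lemma computable_add (f g : E -> k) :
  computable ee Scal f -> computable ee Scal g ->
  computable ee Scal (fun x => f x + g x).
Proof.
move=> [p pf] [q qg]; exists (PComp PAdd (PPair p q)) => x.
exact: EComp (EPair (pf x) (qg x)) (EAdd (Pair _ _)).
Qed.

Lemma computable_mul (f g : E -> k) :
  computable ee Scal f -> computable ee Scal g ->
  computable ee Scal (fun x => f x * g x).
Proof.
move=> [p pf] [q qg]; exists (PComp PMul (PPair p q)) => x.
exact: EComp (EPair (pf x) (qg x)) (EMul (Pair _ _)).
Qed.

Lemma computable_opp (f : E -> k) :
  computable ee Scal f -> computable ee Scal (fun x => - f x).
Proof.
move=> [p pf]; exists (PComp POpp p) => x; exact: EComp (pf x) (EOpp (Scal _)).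
Qed.

Lemma computable_inv (f : E -> k) :
  computable ee Scal f -> computable ee Scal (fun x => (f x)^-1).
Proof.
move=> [p pf]; exists (PComp PInv p) => x; exact: EComp (pf x) (EInv (Scal _)).
Qed.

Lemma computable_eq_scal (f g : E -> k) :
  computable ee Scal f -> computable ee Scal g ->
  computable ee enc_bool (fun x => f x == g x).
Proof.
move=> [p pf] [q qg]; exists (PComp PEqScal (PPair p q)) => x.
exact: EComp (EPair (pf x) (qg x)) (EEqScal (Pair _ _)).
Qed.

(** Programs can only compare generators; equality follows by antisymmetry. *)
Lemma computable_eq_gen (f g : E -> X) :
  computable ee Gen f -> computable ee Gen g ->
  computable ee enc_bool (fun x => f x == g x).
Proof.
have Hle (u v : E -> X) : computable ee Gen u -> computable ee Gen v ->
    computable ee enc_bool (fun x => (u x <= v x)%O).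
  move=> [p pu] [q qv]; exists (PComp PLeGen (PPair p q)) => x.
  exact: EComp (EPair (pu x) (qv x)) (ELeGen (Pair _ _)).
move=> Hf Hg; apply: (eq_computable (f := fun x =>
  if (f x <= g x)%O then (g x <= f x)%O else false)).
  by move=> x; rewrite eq_le.
by apply: computable_if; [exact: Hle | exact: Hle | exact: computable_const].
Qed.

End Primitives.
End ComputableLists.

(** * The decision procedure on presentations *)

Section Algorithm.
Context (k : fieldType) (disp : Order.disp_t) (X : orderType disp).
Local Notation letter := (letter X).
Local Notation presentation := (presentation k X).
Implicit Types (l : letter) (u w : seq letter) (t v g : presentation).

Definition coef w t : k :=
  foldr (fun m c => if perm_eq m.2 w then m.1 + c else c) 0 t.

(* A word with nonzero coefficient in [t] if there is one: [t] denotes 0 iff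
   [coef (pivot t) t = 0]. *)
Definition pivot t : seq letter :=
  foldr (fun m w => if coef m.2 t == 0 then w else m.2) [::] t.

Definition scale (c : k) t : presentation := [seq (c * m.1, m.2) | m <- t].

(* If [v] denotes 0 then the divisor below is 0, so is the quotient, and [g] is
   left unchanged: the elimination need not treat this case separately. *)
Definition reduce v g : presentation :=
  g ++ scale (- (coef (pivot v) g / coef (pivot v) v)) v.

(** The state is the remaining spanning family and the target. The head of the family is eliminated
    from both and then dropped, so after [size V] steps only a remainder to be tested for zero is
    left. *)
Definition elim_step (st : seq presentation * presentation) :=
  ([seq reduce (head [::] st.1) g | g <- behead st.1],
   reduce (head [::] st.1) st.2).

Definition in_span (V : seq presentation) t : bool :=
  let r := (iter (size V) elim_step (V, t)).2 in coef (pivot r) r == 0.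

(** The second component lists the Leibniz summands of [D w]. A fold does not see the tail of the
    list, so the first component rebuilds it. *)
Definition derive_word w : seq letter * seq (seq letter) :=
  foldr (fun l r => (l :: r.1, (next_letter l :: r.1) :: map (cons l) r.2))
    ([::], [::]) w.

Definition derive t : presentation :=
  flatten [seq [seq (m.1, w) | w <- (derive_word m.2).2] | m <- t].

Definition mul_letter l t : presentation := [seq (m.1, l :: m.2) | m <- t].

(** Keeping [V] makes the rounds cumulative, so nothing reached in fewer rounds is lost. *)
Definition grow (ls : seq letter) (V : seq presentation) :=
  V ++ map derive V ++ flatten [seq map (mul_letter l) V | l <- ls].

Definition letters_below (n : nat) (V : seq presentation) : seq letter :=
  iter n (fun ls => ls ++ map (@next_letter X) ls)
    [seq (l.1, 0%N) | l <- flatten [seq flatten (map snd t) | t <- V]].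

(** This is [DXlen] on lists of letters ([DXlenE]): a letter [(a, i)] counts [i] derivations and one
    generator. *)
Definition word_length w : nat := foldr (fun l n => l.2.+1 + n)%N 0%N w.

(** Any upper bound on the lengths of the listed words will do; the sum stands in for the
    maximum. *)
Definition total_length t : nat :=
  foldr (fun m n => word_length m.2 + n)%N 0%N t.

Definition decide (V : seq presentation) t : bool :=
  let n := total_length t in
  in_span (iter n (grow (letters_below n (t :: V))) V) t.

(** * Computability of the decision procedure *)

Local Notation data := (data k X).
Let eB : bool -> data := @of_bool k _ X.
Let eN : nat -> data := @enc_nat k _ X.
Let eK : k -> data := Scal.
Let eL : letter -> data := enc_pair Gen eN.
Let eW : seq letter -> data := enc_seq eL.
Let eM : k * seq letter -> data := enc_pair eK eW.
Let eP : presentation -> data := enc_seq eM.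

Lemma computable_perm_eq :
  computable (enc_pair eW eW) eB (fun x => perm_eq x.1 x.2).
Proof.
have Hletter : computable (enc_pair eL eL) eB (fun x => x.1 == x.2).
  apply: (eq_computable (f := fun x =>
    if x.1.1 == x.2.1 then x.1.2 == x.2.2 else false)) => //.
  apply: computable_if; last exact: computable_const.
    by apply: computable_eq_gen; computable_proj.
  by apply: computable_eqn; computable_proj.
have Hcount : computable (enc_pair eL eW) eN (fun x => count_mem x.1 x.2).
  apply: (eq_computable (f := fun x =>
    foldr (fun l n => (if l == x.1 then 1 else 0) + n)%N 0%N x.2)).
    by move=> [l w] /=; elim: w => //= a w ->; case: (a == l).
  apply: (computable_foldr
    (f := fun x l n => ((if l == x.1 then 1 else 0) + n)%N));
    [|exact: computable_const|computable_proj].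
  apply: computable_addn; last computable_proj.
  apply: computable_if; [|exact: computable_const..].
  by apply: (computable2 (g := fun l l' => l == l') Hletter); computable_proj.
(* This is the definition of [perm_eq]: counts agree at every letter of the concatenation. *)
apply: (computable_all
    (a := fun x l => count_mem l x.1 == count_mem l x.2)).
  by apply: computable_eqn;
    apply: (computable2 (g := fun l w => count_mem l w) Hcount);
    computable_proj.
by apply: computable_cat; computable_proj.
Qed.

Lemma computable_coef : computable (enc_pair eW eP) eK (fun x => coef x.1 x.2).
Proof.
apply: (computable_foldr
  (f := fun x m c => if perm_eq m.2 x.1 then m.1 + c else c));
  [|exact: computable_const|computable_proj].
apply: computable_if; last computable_proj.
  by apply: (computable2 computable_perm_eq); computable_proj.
by apply: computable_add; computable_proj.
Qed.

Lemma computable_pivot : computable eP eW pivot.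
Proof.
apply: (computable_foldr
  (f := fun t m w => if coef m.2 t == 0 then w else m.2));
  [|exact: computable_const|computable_proj].
apply: computable_if; [|computable_proj|computable_proj].
apply: computable_eq_scal; last exact: computable_const.
by apply: (computable2 computable_coef); computable_proj.
Qed.

Lemma computable_reduce :
  computable (enc_pair eP eP) eP (fun x => reduce x.1 x.2).
Proof.
have Hpivot : computable (enc_pair eP eP) eW (fun x => pivot x.1).
  by apply: (computable_comp computable_pivot); computable_proj.
have Hscale : computable (enc_pair eK eP) eP (fun x => scale x.1 x.2).
  apply: (computable_map (f := fun x m => (x.1 * m.1, m.2)));
    last computable_proj.
  apply: computable_pair; last computable_proj.
  by apply: computable_mul; computable_proj.
apply: computable_cat; first computable_proj.
apply: (computable2 Hscale); last computable_proj.
apply/computable_opp/computable_mul; last apply/computable_inv;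
  apply: (computable2 computable_coef); by computable_proj.
Qed.

Lemma computable_in_span :
  computable (enc_pair (enc_seq eP) eP) eB (fun x => in_span x.1 x.2).
Proof.
have Hhead : computable (enc_pair (enc_seq eP) eP) eP (fun x => head [::] x.1).
  by apply: computable_head_nil; computable_proj.
have Hstep : computable (enc_pair (enc_seq eP) eP) (enc_pair (enc_seq eP) eP)
    elim_step.
  apply: computable_pair.
    apply: (computable_map (f := fun st g => reduce (head [::] st.1) g)).
      apply: (computable2 computable_reduce); last computable_proj.
      by apply: computable_head_nil; computable_proj.
    by apply: computable_behead; computable_proj.
  by apply: (computable2 computable_reduce); computable_proj.
have Hr : computable (enc_pair (enc_seq eP) eP) eP
    (fun x => (iter (size x.1) elim_step (x.1, x.2)).2).
  apply: computable_snd; apply: (computable_iter (f := fun=> elim_step)).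
  - by apply: (computable_comp Hstep); computable_proj.
  - by apply: computable_size; computable_proj.
  - by apply: computable_pair; computable_proj.
apply: computable_eq_scal; last exact: computable_const.
apply: (computable2 computable_coef) => //.
by apply: (computable_comp computable_pivot).
Qed.

Lemma computable_derive : computable eP eP derive.
Proof.
apply: computable_flatten.
apply: (computable_map
  (f := fun _ m => [seq (m.1, w) | w <- (derive_word m.2).2]));
  last computable_proj.
apply: (computable_map (f := fun x w => (x.2.1, w))).
  by apply: computable_pair; computable_proj.
apply: (computable_snd (ea := eW)).
apply: (computable_foldr (f := fun _ l r =>
  (l :: r.1, (next_letter l :: r.1) :: map (cons l) r.2)));
  [|exact: computable_const|computable_proj].
apply: computable_pair; first by apply: computable_cons; computable_proj.
apply: computable_cons.
  apply: computable_cons; last computable_proj.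
  apply: computable_pair; first computable_proj.
  by apply: computable_succn; computable_proj.
apply: (computable_map (f := fun x w => x.2.1 :: w)); last computable_proj.
by apply: computable_cons; computable_proj.
Qed.

Lemma computable_grow :
  computable (enc_pair eW (enc_seq eP)) (enc_seq eP) (fun x => grow x.1 x.2).
Proof.
apply: computable_cat; first computable_proj.
apply: computable_cat.
  apply: (computable_map (f := fun=> derive)); last computable_proj.
  by apply: (computable_comp computable_derive); computable_proj.
apply: computable_flatten.
apply: (computable_map (f := fun x l => map (mul_letter l) x.2));
  last computable_proj.
apply: (computable_map (f := fun x => mul_letter x.2)); last computable_proj.
apply: (computable_map (f := fun x m => (m.1, x.1.2 :: m.2)));
  last computable_proj.
apply: computable_pair; first computable_proj.
by apply: computable_cons; computable_proj.
Qed.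

Lemma computable_letters_below :
  computable (enc_pair eN (enc_seq eP)) eW (fun x => letters_below x.1 x.2).
Proof.
apply: (computable_iter (f := fun _ ls => ls ++ map (@next_letter X) ls));
  [|computable_proj|].
  apply: computable_cat; first computable_proj.
  apply: (computable_map (f := fun=> @next_letter X)); last computable_proj.
  apply: computable_pair; first computable_proj.
  by apply: computable_succn; computable_proj.
apply: (computable_map (f := fun _ l => (l.1, 0%N))).
  apply: computable_pair; first computable_proj; exact: computable_const.
apply: computable_flatten.
apply: (computable_map (f := fun _ t => flatten (map snd t)));
  last computable_proj.
apply: computable_flatten; apply: (computable_map (f := fun=> snd));
  by computable_proj.
Qed.

Lemma computable_total_length : computable eP eN total_length.
Proof.
apply: (computable_foldr (f := fun _ m n => (word_length m.2 + n)%N));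
  [|exact: computable_const|computable_proj].
apply: computable_addn; last computable_proj.
apply: (computable_foldr (f := fun _ l n => (l.2.+1 + n)%N));
  [|exact: computable_const|computable_proj].
apply: computable_addn; last computable_proj.
by apply: computable_succn; computable_proj.
Qed.

(** Only the presentation to be tested is input; [V] is written into the program as a constant. *)
Lemma computable_decide (V : seq presentation) :
  computable (@encode k _ X) eB (decide V).
Proof.
change (computable eP eB (decide V)).
apply: (computable2 computable_in_span); last computable_proj.
apply: (computable_iter (f := fun t =>
  grow (letters_below (total_length t) (t :: V))));
  [|exact: computable_total_length|exact: computable_const].
apply: (computable2 computable_grow); last computable_proj.
apply: (computable2 computable_letters_below).
  by apply: (computable_comp computable_total_length); computable_proj.
by apply: computable_cons; [computable_proj | exact: computable_const].
Qed.

End Algorithm.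

(** * Linear spans and one step of Gaussian elimination *)

Section LinearSpan.
Context (k : fieldType) (V : lmodType k).
Implicit Types (vs : seq V) (f g v : V).

(** The recursive form splits off one vector at a time, as the elimination does. *)
Fixpoint lin_span vs f : Prop :=
  if vs is v :: vs' then exists c, lin_span vs' (f - c *: v) else f = 0.

Lemma lin_span0 vs : lin_span vs 0.
Proof. by elim: vs => //= v vs IH; exists 0; rewrite scale0r subrr. Qed.

Lemma lin_spanD vs f g : lin_span vs f -> lin_span vs g -> lin_span vs (f + g).
Proof.
elim: vs f g => [|v vs IH] f g /=; first by move=> -> ->; rewrite addr0.
move=> [a Ha] [b Hb]; exists (a + b).
by rewrite scalerDl opprD addrACA; apply: IH.
Qed.

Lemma lin_spanZ vs c f : lin_span vs f -> lin_span vs (c *: f).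
Proof.
elim: vs f => [|v vs IH] f /=; first by move=> ->; rewrite scaler0.
by move=> [a Ha]; exists (c * a); rewrite -scalerA -scalerBr; apply: IH.
Qed.

Lemma lin_span_mem vs v : v \in vs -> lin_span vs v.
Proof.
elim: vs => //= w vs IH; rewrite inE => /orP[/eqP <-|vs_v].
  by exists 1; rewrite scale1r subrr; apply: lin_span0.
by exists 0; rewrite scale0r subr0; apply: IH.
Qed.

Lemma lin_span_map (r : {linear V -> V}) vs f :
  lin_span vs f -> lin_span (map r vs) (r f).
Proof.
elim: vs f => [|v vs IH] f /=; first by move=> ->; rewrite linear0.
by move=> [c /IH Hc]; exists c; rewrite -linearZ_LR -linearB.
Qed.

(** The map [r g = g - (phi g / phi v) *: v] is linear, kills [v], and moves every vector by a
    multiple of [v]. The first two facts give one direction, the third the other. If [phi v = 0],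
    then [v = 0] and [r] is the identity. *)
Lemma lin_span_elim (phi : V -> k) v vs f : linear_for *%R phi ->
  (phi v = 0 -> v = 0) ->
  lin_span (v :: vs) f <->
  lin_span [seq g - (phi g / phi v) *: v | g <- vs] (f - (phi f / phi v) *: v).
Proof.
move=> phiL phi_v; pose r g := g - (phi g / phi v) *: v.
have rL : linear r.
  move=> a x y; rewrite /r phiL scalerBr scalerA addrACA -opprD -scalerDl.
  by rewrite mulrDl mulrA.
have rv : r v = 0.
  rewrite /r; have [/phi_v->|nz] := eqVneq (phi v) 0.
    by rewrite scaler0 subr0.
  by rewrite divff // scale1r subrr.
pose R : {linear V -> V} := HB.pack r (GRing.isLinear.Build _ _ _ _ r rL).
rewrite -/(r f) -[map _ _]/(map r vs); split=> [[c Hc]|].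
  have := lin_span_map R Hc.
  rewrite (_ : R (f - c *: v) = r f) //.
  by rewrite linearB linearZ_LR /= rv scaler0 subr0.
suff {f} H h : lin_span (map r vs) h -> lin_span (v :: vs) h.
  move=> /H[c Hc]; exists (c + phi f / phi v); rewrite scalerDl opprD addrA.
  by rewrite addrAC.
elim: vs h => [|w vs IH] h.
  by move=> /= ->; exists 0; rewrite scale0r subrr.
(* Replacing [r w] by [w] with coefficient [a] shifts the coefficient of [v] by
   [a * (phi w / phi v)]. *)
case=> a /IH[c Hc]; exists (c - a * (phi w / phi v)), a.
congr (lin_span _ _): Hc.
by rewrite /r scalerBr scalerBl scalerA !opprB !addrA; exact: addrAC.
Qed.

End LinearSpan.

(** * What the operations on presentations denote *)

Section Denotation.
Context (k : fieldType) (disp : Order.disp_t) (X : orderType disp).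
Local Notation letter := (letter X).
Local Notation presentation := (presentation k X).
Implicit Types (l : letter) (u w : seq letter) (t v g : presentation).

Definition monomial w : word X := foldr (fun l m => mmul (ucm l) m) mone w.

Lemma monomialE w l : monomial w l = count_mem l w.
Proof. by elim: w => [|a w IH] /=; rewrite ?cm1 // cmM cmU IH. Qed.

Lemma eq_monomial u w : (monomial u == monomial w) = perm_eq u w.
Proof.
apply/idP/idP => [/cmP uw|/permP uw]; last first.
  by apply/cmP => l; rewrite !monomialE uw.
by apply/allP => l _ /=; rewrite -!monomialE uw.
Qed.

Lemma prod_var w : \prod_(l <- w) var k l = << monomial w >>.
Proof.
elim: w => [|l w IH]; first by rewrite big_nil.
by rewrite big_cons IH; exact: mulUU.
Qed.

Lemma denote_cons m t : denote (m :: t) = m.1 *: << monomial m.2 >> + denote t.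
Proof. by rewrite /denote big_cons prod_var. Qed.

Lemma denote_nil : denote [::] = 0 :> dpoly k X.
Proof. exact: big_nil. Qed.

Lemma denote_cat t g : denote (t ++ g) = denote t + denote g.
Proof. exact: big_cat. Qed.

Lemma coefE w t : coef w t = (denote t)@_(monomial w).
Proof.
elim: t => [|m t IH]; first by rewrite denote_nil mcoeff0.
rewrite denote_cons mcoeffD mcoeffZ mcoeffU1 /= IH eq_monomial.
by case: perm_eq; rewrite ?mulr1 // mulr0 add0r.
Qed.

Lemma pivotP t : coef (pivot t) t = 0 -> denote t = 0.
Proof.
move=> p0; have t0 m : m \in t -> coef m.2 t = 0.
  move: p0; rewrite /pivot; set F := fun m w => _.
  (* Induction on the list that is folded and searched; the [t] inside [coef] stays fixed. *)
  elim: {1 3}t => //= a r IH; rewrite {1}/F inE.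
  case: ifP => [/eqP a0 /IH Hr /orP[/eqP->|/Hr]|] // ne0 /eqP.
  by rewrite ne0.
apply/malgP => c; rewrite mcoeff0.
have [/hasP[m tm /eqP <-]|] := boolP (has (fun m => monomial m.2 == c) t).
  by rewrite -coefE t0.
elim: t {p0 t0} => [|m t IH]; first by rewrite denote_nil mcoeff0.
rewrite /= negb_or => /andP[/negPf mc /IH tc].
by rewrite denote_cons mcoeffD mcoeffZ mcoeffU1 mc mulr0 add0r.
Qed.

Lemma denote_scale c t : denote (scale c t) = c *: denote t.
Proof.
elim: t => [|m t IH]; first by rewrite denote_nil scaler0.
by rewrite !denote_cons IH /= scalerDr scalerA.
Qed.

Lemma denote_reduce v g : denote (reduce v g) = denote g -
  ((denote g)@_(monomial (pivot v)) / (denote v)@_(monomial (pivot v)))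
    *: denote v.
Proof. by rewrite denote_cat denote_scale !coefE scaleNr. Qed.

(** Each step is [lin_span_elim] for the coefficient at the pivot of the head. By [pivotP] this
    coefficient vanishes only if the head denotes 0. *)
Lemma in_spanP (V : seq presentation) t :
  in_span V t <-> lin_span [seq denote v | v <- V] (denote t).
Proof.
rewrite /in_span; move sV: (size V) => n.
elim: n V t sV => [|n IH] [|v V] t //.
  by move=> _ /=; split=> [/eqP/pivotP|t0] //; rewrite coefE t0 mcoeff0.
move=> [sV]; rewrite iterSr.
apply: (iff_trans (IH [seq reduce v g | g <- V] (reduce v t) _)).
  by rewrite size_map.
rewrite denote_reduce -map_comp.
rewrite (@lin_span_elim _ _ (mcoeff (monomial (pivot v)))).
- by rewrite -map_comp (eq_map (denote_reduce v)).
- by move=> c f g; rewrite mcoeffD mcoeffZ.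
- by rewrite -coefE; apply: pivotP.
Qed.

Lemma denote_mul_letter l t : denote (mul_letter l t) = var k l * denote t.
Proof.
elim: t => [|m t IH]; first by rewrite denote_nil mulr0.
rewrite !denote_cons IH mulrDr; congr (_ + _).
by rewrite -[in RHS]mul_malgC mulrCA mul_malgC mulUU.
Qed.

Lemma derive_word1 w : (derive_word w).1 = w.
Proof. by elim: w => //= l w ->. Qed.

Lemma denote_derive t : denote (derive t) = D (denote t).
Proof.
have denote_const (c : k) (s : seq (seq letter)) :
    denote [seq (c, w) | w <- s] = c *: \sum_(w <- s) << monomial w >>.
  elim: s => [|w s IH]; first by rewrite big_nil scaler0 /= denote_nil.
  by rewrite [map _ _]/= denote_cons IH big_cons scalerDr.
have D_monomial w :
    \sum_(u <- (derive_word w).2) << monomial u >> = D << monomial w >>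
    :> dpoly k X.
  elim: w => [|l w IH]; first by rewrite big_nil D_one.
  have -> : << monomial (l :: w) >> = var k l * << monomial w >>.
    exact: esym (mulUU k _ _).
  apply: esym; apply: etrans (D_mul _ _) _.
  rewrite [derive_word _]/= big_cons derive_word1 big_map.
  apply: etrans (congr2 (fun a b => a * << monomial w >> + var k l * b)
    (D_var k l) (esym IH)) _.
  congr (_ + _); first exact: mulUU.
  by apply: etrans (mulr_sumr _ _ _ _) _; apply: eq_bigr => u _; exact: mulUU.
elim: t => [|m t IH]; first by rewrite denote_nil linear0.
rewrite [derive _]/= denote_cat denote_const IH denote_cons D_monomial.
exact: esym (D_is_linear _ _ _).
Qed.

End Denotation.

(** * Homogeneity, truncation and the growth of the spanning family *)

Section Correctness.
Context (k : fieldType) (disp : Order.disp_t) (X : orderType disp).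
Local Notation letter := (letter X).
Local Notation presentation := (presentation k X).
Implicit Types (l : letter) (u w : seq letter) (t v g : presentation).
Implicit Types (G : seq X) (ls : seq letter) (V : seq presentation).

Lemma word_lengthE w : word_length w = sumn [seq l.2.+1 | l <- w].
Proof. by elim: w => //= l w ->. Qed.

Definition word_letters (c : word X) : seq letter :=
  flatten [seq nseq (c l) l | l <- finsupp c].

Lemma word_lettersK : cancel word_letters (@monomial _ X).
Proof.
move=> c; apply/eqP/cmP => l; rewrite monomialE count_flatten -map_comp.
rewrite sumnE big_map (eq_bigr (fun i => (i == l) * c i)%N); last first.
  by move=> i _ /=; rewrite count_nseq.
have [lc|lc] := boolP (l \in finsupp c); last first.
  rewrite big1_seq => [|i /andP[_ ic]].
    by apply/esym/eqP; rewrite cmE_eq0.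
  by case: eqP => // il; rewrite -il ic in lc.
rewrite (bigD1_seq l) //= eqxx mul1n big1 ?addn0 // => i /negPf ->.
by rewrite mul0n.
Qed.

Lemma DXlenE (c : word X) : DXlen c = Posz (word_length (word_letters c)).
Proof.
rewrite /DXlen /wt mdegE word_lengthE sumnE big_map big_flatten /= big_map.
(* The contribution of one letter with [n] derivations and multiplicity [m]: [(n - 1) + 2 = n + 1]
   per occurrence. *)
have step (a : int) (b d m n : nat) : a + 2 * d%:Z = b ->
    m%:Z * (n%:Z - 1) + a + 2 * (m + d)%N%:Z = (m * n.+1 + b)%N by nia.
elim: (enum_fset (finsupp c)) => [|l r IH]; first by rewrite !big_nil.
by rewrite !big_cons big_nseq iter_addn_0 mulnC; apply: step.
Qed.

(** One term is listed per word of the support. An arbitrary presentation could contain cancelling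
    words of other lengths. *)
Lemma exists_presentation (s : dpoly k X) :
  (forall b c, b \in msupp s -> c \in msupp s -> DXlen b = DXlen c) ->
  exists t, denote t = s /\ exists d, all (fun m => word_length m.2 == d) t.
Proof.
move=> sH; exists [seq (s@_c, word_letters c) | c <- msupp s]; split.
  rewrite [RHS]monalgE /denote big_map; apply: eq_bigr => c _.
  rewrite prod_var word_lettersK; exact: esym (malgUE _ _).
have [s0|[c0 c0s]] := fset_0Vmem (msupp s).
  exists 0%N; apply/allP => m /mapP[c cs _]; have : c \in msupp s by [].
  by rewrite s0 inE.
exists (word_length (word_letters c0)); apply/allP => _ /mapP[c cs ->] /=.
by have := sH _ _ cs c0s; rewrite !DXlenE => -[->].
Qed.

Definition letters_in G w : bool := all (fun l => l.1 \in G) w.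

Definition within G n w : bool := letters_in G w && (word_length w <= n)%N.

Lemma perm_within G n u w : perm_eq u w -> within G n u = within G n w.
Proof.
move=> uw; rewrite /within /letters_in (perm_all _ uw) !word_lengthE.
by rewrite (perm_sumn (perm_map _ uw)).
Qed.

Definition restrict (p : pred (word X)) (f : dpoly k X) : dpoly k X :=
  [malg c in msupp f => if p c then f@_c else 0].

Lemma mcoeff_restrict p f c : (restrict p f)@_c = if p c then f@_c else 0.
Proof.
rewrite mcoeffE; case: ifP => // /negbT/mcoeff_outdom ->.
by rewrite if_same.
Qed.

Lemma restrict_is_linear p : linear (restrict p).
Proof.
move=> a f g; apply/malgP => c; rewrite mcoeffD mcoeffZ !mcoeff_restrict.
by rewrite mcoeffD mcoeffZ; case: ifP; rewrite // mulr0 addr0.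
Qed.

HB.instance Definition _ p := GRing.isLinear.Build k (dpoly k X) (dpoly k X)
  *:%R (restrict p) (restrict_is_linear p).

Local Notation truncate G n :=
  (restrict (fun c => within G n (word_letters c))).

(** [within] depends on a list only up to permutation, so the projection on polynomials can be
    computed term by term, even when terms cancel. *)
Lemma truncate_denote G n t :
  truncate G n (denote t) = denote [seq m <- t | within G n m.2].
Proof.
elim: t => [|m t IH]; first by rewrite /= denote_nil; apply: linear0.
have truncate_m : truncate G n << monomial m.2 >> =
    if within G n m.2 then << monomial m.2 >> else 0.
  have perm_m : perm_eq (word_letters (monomial m.2)) m.2.
    by rewrite -eq_monomial word_lettersK.
  apply/malgP => c; rewrite mcoeff_restrict.
  have [->|mc] := eqVneq c (monomial m.2).
    by rewrite (perm_within _ _ perm_m); case: ifP; rewrite ?mcoeff0.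
  rewrite mcoeffU1 eq_sym (negPf mc) if_same.
  by case: ifP; rewrite ?mcoeff0 // mcoeffU1 eq_sym (negPf mc).
rewrite denote_cons; apply: etrans (restrict_is_linear _ _ _ _) _.
apply: etrans (congr2 (fun a b => m.1 *: a + b) truncate_m IH) _ => /=.
by case: ifP => _; rewrite ?denote_cons // scaler0 add0r.
Qed.

(** The listed words share one length and are all over [G] or all not over [G], according to [b].
    Truncation therefore keeps or drops the presentation as a whole. *)
Definition uniform G (b : bool) (d : nat) t : bool :=
  all (fun m => (word_length m.2 == d) && (letters_in G m.2 == b)) t.

Lemma uniform_derive G b d t : uniform G b d t -> uniform G b d.+1 (derive t).
Proof.
have Hw w : all (fun u => (word_length u == (word_length w).+1) &&
    (letters_in G u == letters_in G w)) (derive_word w).2.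
  elim: w => //= l w IH; rewrite derive_word1 !eqxx /= all_map.
  apply: sub_all IH => u /andP[/eqP u1 /eqP u2] /=.
  by rewrite u1 u2 addnS !eqxx.
move=> /allP tU; apply/allP => m /flattenP[_ /mapP[m' /tU mU ->]].
case/mapP=> w /(allP (Hw m'.2))/andP[/eqP w1 /eqP w2] -> /=.
by rewrite w1 w2 eqSS.
Qed.

Lemma uniform_mul_letter G b d l t : uniform G b d t ->
  uniform G ((l.1 \in G) && b) (l.2.+1 + d)%N (mul_letter l t).
Proof.
rewrite /uniform all_map; apply: sub_all => m /andP[/eqP <- /eqP <-] /=.
by rewrite !eqxx.
Qed.

Definition mul_word u t : presentation := foldr (@mul_letter k _ X) t u.

Lemma denote_mul_word u t :
  denote (mul_word u t) = << monomial u >> * denote t.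
Proof.
elim: u => [|l u IH] /=; first exact: esym (mul1r _).
apply: etrans (denote_mul_letter _ _) _; rewrite IH.
by apply: etrans (mulrA _ _ _) _; congr (_ * _); exact: mulUU.
Qed.

Lemma uniform_mul_word G b d u t : uniform G b d t ->
  uniform G (letters_in G u && b) (word_length u + d)%N (mul_word u t).
Proof.
move=> tU; elim: u => //= l u IH; rewrite -andbA -addnA.
exact: uniform_mul_letter.
Qed.

Lemma grow_mono ls V m n t : (m <= n)%N ->
  t \in iter m (grow ls) V -> t \in iter n (grow ls) V.
Proof.
move=> /subnK <- tm; elim: (n - m)%N => //= j IH.
by rewrite /grow mem_cat IH.
Qed.

Lemma grow_derive ls V n t :
  t \in iter n (grow ls) V -> derive t \in iter n.+1 (grow ls) V.
Proof. by move=> tn; rewrite /= /grow !mem_cat map_f ?orbT. Qed.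

(** One further round per letter of [u]. *)
Lemma grow_mul_word ls V n u t : {subset u <= ls} ->
  t \in iter n (grow ls) V -> mul_word u t \in iter (size u + n) (grow ls) V.
Proof.
move=> uls tn; elim: u uls => //= l u IH uls.
rewrite {1}/grow !mem_cat; apply/orP; right; apply/orP; right.
apply/flattenP.
exists [seq mul_letter l g | g <- iter (size u + n) (grow ls) V].
  by apply/mapP; exists l => //; apply: uls; rewrite mem_head.
by apply/map_f/IH => l' l'u; apply: uls; rewrite inE l'u orbT.
Qed.

Definition generators V : seq X :=
  [seq l.1 | l <- flatten [seq flatten (map snd t) | t <- V]].

Lemma mem_generators V t m l :
  t \in V -> m \in t -> l \in m.2 -> l.1 \in generators V.
Proof.
move=> Vt tm ml; apply: map_f; apply/flattenP; exists (flatten (map snd t)).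
  by apply/mapP; exists t.
by apply/flattenP; exists m.2 => //; apply: map_f.
Qed.

Lemma mem_letters_below n V l :
  l.1 \in generators V -> (l.2 <= n)%N -> l \in letters_below n V.
Proof.
case: l => a i /= aV; elim: n i => [|n IH] i.
  rewrite leqn0 => /eqP ->; case/mapP: aV => l Vl ->.
  by apply/mapP; exists l.
rewrite leq_eqVlt /= mem_cat => /orP[/eqP ->|/IH -> //].
by apply/orP; right; apply/mapP; exists (a, n) => //; apply: IH.
Qed.

Lemma size_word_length u : (size u <= word_length u)%N.
Proof.
by elim: u => //= l u IH; rewrite addSn ltnS (leq_trans IH) ?leq_addl.
Qed.

Lemma mem_word_length u l : l \in u -> (l.2 < word_length u)%N.
Proof.
elim: u => //= a u IH; rewrite inE => /orP[/eqP ->|/IH lu].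
  by rewrite leq_addr.
by rewrite (leq_trans lu) ?leq_addl.
Qed.

Lemma word_length_total t m :
  m \in t -> (word_length m.2 <= total_length t)%N.
Proof.
elim: t => //= a t IH; rewrite inE => /orP[/eqP ->|/IH mt].
  by rewrite leq_addr.
by rewrite (leq_trans mt) ?leq_addl.
Qed.

Lemma diff_ideal_Id (S : {fset dpoly k X}) : diff_ideal (Id S).
Proof.
split.
- by move=> I [].
- by move=> f g Hf Hg I HI HS; apply: diff_idealD; [|apply: Hf|apply: Hg].
- by move=> h f Hf I HI HS; apply: diff_idealM; [|apply: Hf].
- by move=> f Hf I HI HS; apply: diff_idealder; [|apply: Hf].
Qed.

Lemma lin_span_ideal (I : dpoly k X -> Prop) (vs : seq (dpoly k X))
    (f : dpoly k X) :
  diff_ideal I -> {in vs, forall h, I h} -> lin_span vs f -> I f.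
Proof.
move=> HI; elim: vs f => [|v vs IH] f vsI /=.
  by move=> ->; apply: diff_ideal0.
case=> c /IH If; rewrite -(subrK (c *: v) f); apply: diff_idealD => //.
  by apply: If => g gvs; apply: vsI; rewrite inE gvs orbT.
by rewrite -mul_malgC; apply: diff_idealM => //; apply: vsI; rewrite mem_head.
Qed.

(** * Soundness and completeness of the decision procedure *)

Section Decide.
Context (S : {fset dpoly k X}) (V : seq presentation).
Hypothesis denoteV : [seq denote v | v <- V] =i S.
Hypothesis homV :
  forall v, v \in V -> exists d, all (fun m => word_length m.2 == d) v.

Lemma decide_sound t : decide V t -> Id S (denote t).
Proof.
move=> /in_spanP; apply: lin_span_ideal; first exact: diff_ideal_Id.
have [I0 ID IM Ider] := diff_ideal_Id S.
(* The letter list depends on the number of rounds; it is generalized before the induction on that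
   number. *)
move=> _ /mapP[g gV ->]; move: (letters_below _ _) gV => ls.
elim: (total_length t) g => [|n IH] g /=.
  move=> gV I _; apply; rewrite -denoteV; exact: map_f.
rewrite {1}/grow !mem_cat => /or3P[/IH //|/mapP[h /IH Ih ->]|].
  by rewrite denote_derive; apply: Ider.
move=> /flattenP[_ /mapP[l _ ->]] /mapP[h /IH Ih ->].
by rewrite denote_mul_letter; apply: IM.
Qed.

(* Truncation at the generators of [t] and [S] and at the length of [t] fixes
   [denote t], and it either fixes or kills each [u D^a s], by homogeneity. *)
Lemma decide_complete t : Id S (denote t) -> decide V t.
Proof.
move=> /Id_span[r [rS tE]]; apply/in_spanP.
set n := total_length t; set ls := letters_below n _.
pose G := generators (t :: V).
have -> : denote t = truncate G n (denote t).
  rewrite truncate_denote (_ : [seq m <- t | _] = t) //.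
  apply/all_filterP/allP => m tm; rewrite /within word_length_total // andbT.
  by apply/allP => l; apply: mem_generators tm; rewrite mem_head.
(* By linearity it suffices to treat the truncation of a single [u D^a s]. *)
rewrite tE linear_sum; elim: r rS {tE} => [|[[[c u] a] s] r IHr] /=.
  by rewrite big_nil => _; apply: lin_span0.
case/andP=> sS /IHr{}IHr; rewrite big_cons; apply: lin_spanD => //=.
rewrite linearZ_LR; apply: lin_spanZ.
move: sS; rewrite -denoteV => /mapP[v vV ->].
have [d vd] := homV vV.
pose x := mul_word (word_letters u) (iter a (@derive k _ X) v).
have xE : denote x = << u >> * iter a (@D k X) (denote v).
  rewrite denote_mul_word word_lettersK; congr (_ * _).
  by elim: (a) => //= b IH; rewrite denote_derive IH.
have xU : uniform G (letters_in G (word_letters u))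
    (word_length (word_letters u) + (a + d))%N x.
  (* The generators of [v] belong to [G] and [D] adds no new ones, so only [u] can lead out of
     [G]. *)
  rewrite -[letters_in _ _]andbT; apply: uniform_mul_word.
  elim: (a) => [|b IH]; last exact: uniform_derive.
  apply/allP => m vm; rewrite (allP vd) //= eqb_id.
  by apply/allP => l; apply: mem_generators vm; rewrite inE vV orbT.
rewrite -xE -[X in lin_span _ X]/(truncate G n (denote x)) truncate_denote.
have [uI|uI] := boolP (letters_in G (word_letters u) &&
    (word_length (word_letters u) + (a + d) <= n)%N); last first.
  rewrite (_ : [seq _ <- x | _] = [::]) ?denote_nil; first exact: lin_span0.
  apply/eqP; rewrite -[_ == _]negbK -has_filter; apply/hasPn => m xm.
  by have /andP[/eqP m1 /eqP m2] := allP xU m xm; rewrite /within m1 m2.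
rewrite (_ : [seq _ <- x | _] = x); last first.
  apply/all_filterP/allP => m xm.
  by have /andP[/eqP m1 /eqP m2] := allP xU m xm; rewrite /within m1 m2.
case/andP: uI => uG un; apply/lin_span_mem/map_f.
(* Every letter has length at least 1, so these rounds number at most the length of [u] plus [a],
   hence at most [n]. *)
apply: (@grow_mono _ _ (size (word_letters u) + a)).
  apply: leq_trans un; rewrite addnA; apply: leq_trans (leq_addr _ _).
  by rewrite leq_add2r size_word_length.
apply: grow_mul_word; last first.
  by elim: (a) => // b IH; apply: grow_derive.
move=> l lu; apply: mem_letters_below; first exact: (allP uG).
apply: leq_trans (leq_trans (leq_addr _ _) un); apply/ltnW.
exact: mem_word_length.
Qed.

End Decide.
End Correctness.

Theorem proposition4p1 (k : fieldType) (disp : Order.disp_t)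
    (X : orderType disp) (S : {fset dpoly k X}) :
  [pchar k]%R =i pred0 ->
  well_founded (fun x y : X => (x < y)%O) ->
  S != fset0 ->
  DX_homogeneous S ->
  solvable_word_problem S.
Proof.
move=> _ _ _ homS.
(* This choice need not be effective: [S] is fixed, and [V] becomes a constant of the program. *)
have [V [VS homV]] : exists V : seq (presentation k X),
    [seq denote v | v <- V] = S /\
    forall v, v \in V -> exists d, all (fun m => word_length m.2 == d) v.
  have : {subset (S : seq _) <= S} by [].
  elim: {1 2}(S : seq _) => [|s r IH] sS; first by exists [::].
  have [|V [VE HV]] := IH; first by move=> f fr; apply: sS; rewrite inE fr orbT.
  have [|t [tE Ht]] := @exists_presentation k _ X s.
    by apply: homS; apply: sS; rewrite mem_head.
  exists (t :: V); rewrite /= VE tE; split=> // v.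
  by rewrite inE => /orP[/eqP ->|/HV].
have denoteV : [seq denote v | v <- V] =i S by rewrite VS.
have [p pE] := computable_decide V.
exists p => f t <-; have := pE t; case: (boolP (decide V t)) => [Vt|nVt] evt.
  by split=> // nId; case: nId; apply: decide_sound Vt.
by split=> // /(decide_complete denoteV homV) Vt; rewrite Vt in nVt.
Qed.
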